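(* Let $X_h^n\in H_h^m$, $x_h^n\in H_h$ be solutions of $$B(X_h^n,V_h)=(x_h^n\mathbf d,V_h)_{H_0^m}+(F_n,V_h)_{H_0^m}\quad\forall V_h\in H_h^m,\qquad x_h^{n+1}=R(\infty)x_h^n+b^TA^{-1}X_h^n$$ for given right-hand sides $F_n\in H_0^m$ and initial condition $x_h^0\in H_h$. Then, without any conditions on $k$ or the space $H_h$, the sequence of solutions is non-expansive, i.e. for all $n\in\mathbb N$ $$\|x_h^n\|_{H_0}\le\|x_h^0\|_{H_0}+C\sum_{j=0}^{n-1}\|F_j\|_{H_0^m}.$$ If we also assume that $\widetilde{\mathbf H}(\cdot,\cdot)$ is $H_1$-elliptic, with $\beta_{\widetilde{\mathbf H}}$ as the coercivity constant, then there exists a constant $C>0$ depending only on $\beta_{\widetilde{\mathbf H}}$ and the Runge–Kutta method such that $$\|x_h^n\|_{H_1}\le C\Big(\|x_h^0\|_{H_1}+\sum_{j=0}^{n-1}\inf_{W_h\in H_h^m}\big(\|W_h\|_{H_1^m}+k^{-1/2}\|F_j-W_h\|_{H_0^m}\big)\Big).$$ For discrete right-hand sides $F_j\in H_h^m$ the following stronger estimate is valid (under the same ellipticity assumption): $$\|x_h^n\|_{H_1}\le C\Big(\|x_h^0\|_{H_1}+\sum_{j=0}^{n-1}\|F_j\|_{H_1^m}\Big).$$ In the case that the Runge–Kutta method satisfies $|R(\mathrm it)|=1$ for all $t\in\mathbb R$ and $F_n=0$ for all $n\in\mathbb N$, we get conservation of the $H_0$-norm, i.e. $$\|x_h^n\|_{H_0}=\|x_h^0\|_{H_0}\qquad\forall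 n\in\mathbb N.$$ Under the stricter ellipticity assumption on $\widetilde{\mathbf H}(\cdot,\cdot)$, we then also get conservation of energy: $$\mathbf H(x_h^n,x_h^n)=\mathbf H(x_h^0,x_h^0).$$
   Context: Runge–Kutta method: $A\in\mathbb R^{m\times m}$, $b,c\in\mathbb R^m$, $\mathbb 1=(1,\dots,1)^T$. It is A-stable, i.e. for all $z\in\mathbb C$ with $\Re z\le 0$ the matrix $I-zA$ is invertible and $R(z):=1+zb^T(I-zA)^{-1}\mathbb 1$ satisfies $|R(z)|\le 1$; moreover $A$ is invertible. Put $R(\infty):=1-b^TA^{-1}\mathbb 1$, $\mathbf d:=-\mathrm iA^{-1}\mathbb 1$; $k>0$ is the step size. Matrices and vectors act on elements of product spaces $X^m$ componentwise. Abstract setting: $H_0\supseteq H_1$ are Hilbert spaces, $H_1$ continuously and densely embedded in $H_0$; $H_h\subseteq H_1$ is a closed subspace (equipped with the $H_1$ inner product unless stated otherwise). $\mathbf H:H_1\times H_1\to\mathbb C$ is a bounded Hermitian sesquilinear form, i.e. $\mathbf H(u,v)=\overline{\mathbf H(v,u)}$, and there is a constant $\alpha>0$ such that the stabilized form $\widetilde{\mathbf H}(u,v):=\mathbf H(u,v)+\alpha(u,v)_{H_0}$ satisfies the inf-sup condition $$\inf_{u\in H_h\setminus\{0\}}\sup_{v\in H_h\setminus\{0\}}\frac{|\widetilde{\mathbf H}(u,v)|}{\|u\|_{H_1}\|v\|_{H_1}}\ge\beta_{\widetilde{\mathbf H}}>0.$$ On $H_1^m\times H_1^m$, $\underline{\mathbf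 H}(U,V):=\sum_{j=1}^m\mathbf H(U_j,V_j)$ and $B(U,V):=-(\mathrm iA^{-1}U,V)_{H_0^m}+k\,\underline{\mathbf H}(U,V)$.
   Formalization: The constant in both H_1 estimates may also depend on a bound M for the stabilized form, and in the estimate with the infimum also on an upper bound K for kα; with dependence only on the coercivity constant and the Runge–Kutta method those estimates are false. *)

(* Defs.v *)
From HB Require Import structures.
From mathcomp Require Export all_boot all_order all_algebra.
From mathcomp Require Export all_classical all_reals all_analysis.
From mathcomp Require Export complex.
Import Order.TTheory GRing.Theory Num.Theory.
Import numFieldNormedType.Exports.

Set Implicit Arguments.
Unset Strict Implicit.
Unset Printing Implicit Defensive.

Local Open Scope classical_set_scope.
Local Open Scope ring_scope.
Local Open Scope complex_scope.

(* Complex Hilbert spaces.  A [{dot V for conj}] is linear in its first and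
   antilinear in its second argument. *)
HB.mixin Record isHilbert (R : realType) V of CompleteNormedModule R[i] V := {
  inner : {dot V for (@Num.conj R[i])} ;
  inner_norm : forall u : V, inner u u = `|u| ^+ 2 }.

#[short(type="hilbertType")]
HB.structure Definition Hilbert (R : realType) :=
  { V of isHilbert R V & CompleteNormedModule R[i] V }.

(* The library norm of a normed space over R[i] takes its (real, nonnegative)
   values in R[i]; [rnorm] is the same norm with values in R. *)
Definition rnorm (R : realType) (V : normedZmodType R[i]) (u : V) : R :=
  complex.Re `|u|.

(* Elements of a product space V^m are functions 'I_m -> V. *)
Section ProductSpace.
Variables (R : realType) (m : nat).

Definition pinner (V : hilbertType R) (U W : 'I_m -> V) : R[i] :=
  \sum_j inner (U j) (W j).

Definition pnorm (V : normedZmodType R[i]) (U : 'I_m -> V) : R :=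
  Num.sqrt (\sum_j rnorm (U j) ^+ 2).

Definition mxact (V : lmodType R[i]) (p : nat) (M : 'M[R[i]]_(p, m))
    (U : 'I_m -> V) : 'I_p -> V :=
  fun i => \sum_j M i j *: U j.

End ProductSpace.

Record rk_method (R : realType) (m : nat) := RKMethod {
  rkA : 'M[R]_m;
  rkb : 'cV[R]_m;
  rkc : 'cV[R]_m }.

Local Notation toC := (map_mx (real_complex _)).
Local Notation ones := (const_mx 1 : 'cV_ _).

Section RungeKutta.
Variables (R : realType) (m : nat) (rk : rk_method R m).

Definition stab_mx (z : R[i]) : 'M[R[i]]_m := 1%:M - z *: toC (rkA rk).

Definition stab_fun (z : R[i]) : R[i] :=
  1 + z * ((toC (rkb rk))^T *m invmx (stab_mx z) *m ones) 0 0.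

Definition A_stable : Prop :=
  forall z : R[i], complex.Re z <= 0 ->
    stab_mx z \in unitmx /\ rnorm (stab_fun z) <= 1.

Definition stab_infty : R :=
  1 - ((rkb rk)^T *m invmx (rkA rk) *m ones) 0 0.

Definition rk_iAinv : 'M[R[i]]_m := 'i *: toC (invmx (rkA rk)).

Definition rk_bAinv : 'rV[R[i]]_m := toC ((rkb rk)^T *m invmx (rkA rk)).

Definition rk_d : 'cV[R[i]]_m := - (rk_iAinv *m ones).

End RungeKutta.

Definition inf_sup (R : realType) (V : normedModType R[i]) (S : {pred V})
    (a : V -> V -> R[i]) : \bar R :=
  let S' := [set v | v \in S /\ v != 0] in
  ereal_inf [set
    ereal_sup [set (rnorm (a u v) / (rnorm u * rnorm v))%:E | v in S']
    | u in S'].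

(* H1 is a subspace of H0 through the linear injection [emb]. *)
Record setting (R : realType) := Setting {
  H0 : hilbertType R;
  H1 : hilbertType R;
  emb : {linear H1 -> H0};
  emb_inj : injective emb;
  emb_continuous : continuous emb;
  emb_dense : dense (range emb);
  Hh : submodClosed H1;
  Hh_closed : closed [set` Hh];
  hform : {hermitian_sym H1 for (@Num.conj R[i])};
  form_bounded : exists M : R,
    forall u v : H1, rnorm (hform u v) <= M * (rnorm u * rnorm v);
  alpha : R;
  alpha_gt0 : 0 < alpha;
  beta : R;
  beta_gt0 : 0 < beta;
  form_inf_sup :
    (beta%:E <=
     inf_sup Hh
       (fun u v => (hform u v + alpha%:C * inner (emb u) (emb v))%R))%E }.

Section Scheme.
Variables (R : realType) (S : setting R).

Definition stab_form (u v : H1 S) : R[i] :=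
  hform S u v + (alpha S)%:C * inner (emb S u) (emb S v).

Definition elliptic : Prop :=
  forall u : H1 S, beta S * rnorm u ^+ 2 <= complex.Re (stab_form u u).

(* The energy norm (stab_form u u)^(1/2) lies between sqrt beta and sqrt M times
   the H1-norm; the H1-stability constants depend on both bounds. *)
Definition stab_form_bound (M : R) : Prop :=
  forall u v : H1 S, rnorm (stab_form u v) <= M * (rnorm u * rnorm v).

Variables (m : nat) (rk : rk_method R m) (k : R).

Definition pemb (U : 'I_m -> H1 S) : 'I_m -> H0 S := fun i => emb S (U i).

Definition in_Hh (U : 'I_m -> H1 S) : Prop := forall i, U i \in Hh S.

Definition pform (U V : 'I_m -> H1 S) : R[i] := \sum_j hform S (U j) (V j).

Definition rk_form (U V : 'I_m -> H1 S) : R[i] :=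
  - pinner (mxact (rk_iAinv rk) (pemb U)) (pemb V) + k%:C * pform U V.

Definition rk_solution (F : nat -> 'I_m -> H0 S) (x : nat -> H1 S)
    (X : nat -> 'I_m -> H1 S) : Prop :=
  forall n, [/\ x n \in Hh S,
    in_Hh (X n),
    (forall V : 'I_m -> H1 S, in_Hh V ->
      rk_form (X n) V = pinner (fun i => rk_d rk i 0 *: emb S (x n)) (pemb V)
                  + pinner (F n) (pemb V))
    & x n.+1 = (stab_infty rk)%:C *: x n + mxact (rk_bAinv rk) (X n) 0].

Definition rhs_inf (G : 'I_m -> H0 S) : R :=
  inf [set pnorm W + (Num.sqrt k)^-1 * pnorm (fun i => G i - emb S (W i))
      | W in [set W : 'I_m -> H1 S | in_Hh W]].

End Scheme.

(* Main.v *)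
Require Import Defs.
From mathcomp Require Import all_boot all_order all_algebra perm.
From mathcomp Require Import all_classical all_reals all_analysis.
From mathcomp Require Import complex.
From mathcomp Require Import ring lra.
Import Order.TTheory GRing.Theory Num.Theory.
Local Open Scope ring_scope.
Local Open Scope complex_scope.

(** The stage equations of one step only involve [x n], [x n.+1], the stages
    [X n j] and, when they are discrete, the right-hand sides: finitely many
    vectors of [Hh].  On their span the H0 inner product is positive definite and
    the form is Hermitian, so there is an H0-orthonormal basis of that span in
    which the form is diagonal with real eigenvalues ([eigenfamily_exists]).
    Testing the stage equations with one basis vector in one stage decouples them
    into one [m] by [m] system per eigenvalue.  The basis changes from step to step,
    but the norms that are estimated do not depend on it.

    For the eigenvalue [lam], with [t = k * lam] and [N = i A^-1], the system reads
    [(t - N) Y = xi d + f], and eliminating [Y] gives ([scalar_step])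

      [xi' = R(- i t) xi + r(t) f],   [r(t) = b^T A^-1 (t - N)^-1].

    A-stability says that [|R(- i t)| <= 1] and that [t - N] is invertible for real
    [t].  Since [N] has no real eigenvalue, Cramer's rule improves the latter to
    [(1 + |t|) |r(t)| <= K] uniformly in [t] ([rk_response_bound]).

    Everything then follows from the triangle inequality in the weighted norm
    [(sum_l w_l |xi_l|^2)^(1/2)].  The weight [1] is the H0-norm, where Bessel's inequality
    bounds the data ([H0_step]).  The weight [lam + alpha] is the energy norm of the
    stabilised form, which ellipticity and boundedness make equivalent to the
    H1-norm; discrete data are measured in the same energy norm, and for the rest
    the decay of [r] pays for the weight at the price [k^(-1/2)], because
    [k (lam + alpha)] grows no faster than [1 + |t|] ([energy_step]).  Both
    estimates have factor one in front of the old value, so they add up over the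
    steps.  If [|R| = 1] on the imaginary axis and there are no data, each [|xi_l|]
    is preserved, hence so are the H0-norm and the form itself
    ([conserved_step]). *)

Set Implicit Arguments.
Unset Strict Implicit.

(** * Simultaneous diagonalisation of an inner product and a Hermitian form *)

Section SimultaneousDiagonalisation.
Variables (C : numClosedFieldType) (T U : lmodType C) (e : {linear T -> U}).
Hypothesis e_inj : injective e.
Variables (p : {dot U for (@Num.conj C)}) (h : {hermitian_sym T for (@Num.conj C)}).
Variable M : submodClosed T.

Definition orthonormal_family n (f : 'I_n -> T) : Prop :=
  forall i j, p (e (f i)) (e (f j)) = (i == j)%:R.

Definition expands n (f : 'I_n -> T) (v : T) : Prop :=
  v = \sum_i p (e v) (e (f i)) *: f i.

Lemma hermJ (V : lmodType C) (g : {hermitian_sym V for (@Num.conj C)}) u v :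
  g u v = (g v u)^*%R.
Proof. by rewrite hermC expr0 mul1r. Qed.

Lemma herm_suml (V : lmodType C) (g : {hermitian_sym V for (@Num.conj C)}) n
    (a : 'I_n -> C) (f : 'I_n -> V) v :
  g (\sum_i a i *: f i) v = \sum_i a i * g (f i) v.
Proof.
by rewrite linear_sumlz; apply: eq_bigr => i _; rewrite linearZl_LR.
Qed.

Lemma herm_sumr (V : lmodType C) (g : {hermitian_sym V for (@Num.conj C)}) n
    (a : 'I_n -> C) (f : 'I_n -> V) v :
  g v (\sum_i a i *: f i) = \sum_i (a i)^*%R * g v (f i).
Proof.
by rewrite linear_sumr; apply: eq_bigr => i _; rewrite linearZr_LR.
Qed.

Lemma emb_sum n (a : 'I_n -> C) (f : 'I_n -> T) :
  e (\sum_i a i *: f i) = \sum_i a i *: e (f i).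
Proof. by rewrite linear_sum; apply: eq_bigr => i _; rewrite linearZ. Qed.

Lemma orthonormal_coef n (f : 'I_n -> T) (a : 'I_n -> C) j :
  orthonormal_family f -> p (e (\sum_i a i *: f i)) (e (f j)) = a j.
Proof.
move=> fo; rewrite emb_sum herm_suml (bigD1 j) //= fo eqxx mulr1 big1 ?addr0 //.
by move=> i /negPf ij; rewrite fo ij mulr0.
Qed.

(** Each new vector contributes its residual [w] after projection, or nothing when
    the residual vanishes; injectivity of [e] makes the residual normalisable. *)
Lemma gram_schmidt (s : seq T) : {subset s <= M} ->
  exists n (f : 'I_n -> T),
    [/\ forall i, f i \in M, orthonormal_family f
      & forall v, v \in s -> expands f v].
Proof.
elim: s => [_|v s IH sM].
  by exists 0%N, (fun=> 0); split=> // -[].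
have [|n [f [fM fo fs]]] := IH.
  by move=> u us; apply: sM; rewrite inE us orbT.
pose w := v - \sum_i p (e v) (e (f i)) *: f i.
have [w0|w0] := eqVneq w 0.
  exists n, f; split => // u; rewrite inE => /orP[/eqP->|]; last exact: fs.
  exact: (subr0_eq w0).
have wM : w \in M.
  rewrite /w -scaleN1r; apply: rpredD; first by rewrite sM ?mem_head.
  apply: rpredZ.
  by apply: rpred_sum => i _; apply: rpredZ.
have wf i : p (e w) (e (f i)) = 0.
  have -> : e w = e v - e (\sum_i p (e v) (e (f i)) *: f i) by rewrite -linearB.
  by rewrite linearBl /= orthonormal_coef // subrr.
have ew0 : e w != 0.
  by apply: contra w0 => /eqP ew; apply/eqP/e_inj; rewrite ew linear0.
pose r := sqrtC (p (e w) (e w)).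
have r0 : r != 0 by rewrite sqrtC_eq0 gt_eqF // dnorm_gt0.
have rr : r^*%R = r.
  by apply/CrealP/ger0_real; rewrite sqrtC_ge0 ltW // dnorm_gt0.
pose w' := r^-1 *: w.
have ew' : e w' = r^-1 *: e w by rewrite -linearZ.
have w'f i : p (e w') (e (f i)) = 0.
  by rewrite ew' linearZl_LR /= wf mulr0.
have ww' : p (e w) (e w') = r.
  rewrite ew' linearZr_LR /= fmorphV /= rr.
  by rewrite -[X in _ * X]sqrtCK -/r expr2 mulrA mulVf // mul1r.
pose g (i : 'I_n.+1) := oapp f w' (unlift ord0 i).
have g0 : g ord0 = w' by rewrite /g unlift_none.
have gS i : g (lift ord0 i) = f i by rewrite /g liftK.
exists n.+1, g; split.
- move=> i; rewrite /g; case: unliftP => [j _|_] /=; first exact: fM.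
  exact: rpredZ.
- move=> i j; case: (unliftP ord0 i) => [i' ->|->];
    case: (unliftP ord0 j) => [j' ->|->]; rewrite ?g0 ?gS.
  + by rewrite fo (inj_eq (@lift_inj _ _)).
  + by rewrite hermJ /= w'f conjC0.
  + by rewrite w'f (negPf (neq_lift _ _)).
  + by rewrite eqxx {1}ew' linearZl_LR /= ww' mulVf.
- move=> u; rewrite inE /expands big_ord_recl g0.
  under eq_bigr do rewrite gS.
  have spanw' (a : 'I_n -> C) : p (e (\sum_i a i *: f i)) (e w') = 0.
    rewrite emb_sum herm_suml big1 // => i _.
    by rewrite hermJ /= w'f conjC0 mulr0.
  move=> /orP[/eqP->|us].
    have -> : p (e v) (e w') = r.
      have -> : e v = e w + e (\sum_i p (e v) (e (f i)) *: f i).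
        by rewrite -linearD subrK.
      by rewrite linearDl /= spanw' addr0.
    by rewrite scalerA mulfV // scale1r subrK.
  by rewrite {2}(fs u us) spanw' scale0r add0r; apply: fs.
Qed.

(** The Gram-Schmidt basis turns [h] into a Hermitian matrix; the unitary matrix
    that diagonalises it keeps the basis orthonormal. *)
Lemma simultaneous_diagonalisation (s : seq T) : {subset s <= M} ->
  exists n (f : 'I_n -> T) (l : 'I_n -> C),
    [/\ [/\ forall i, f i \in M, orthonormal_family f
          & forall v, v \in s -> expands f v],
        forall i j, h (f i) (f j) = l i * (i == j)%:R
      & forall i, l i \is Num.real].
Proof.
move=> /gram_schmidt[n [g [gM go gs]]].
pose A := \matrix_(i, j) h (g i) (g j) : 'M[C]_n.
have Aherm : A \is hermsymmx.
  apply/is_hermitianmxP; rewrite expr0 scale1r; apply/matrixP => i j.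
  by rewrite !mxE hermJ.
(* A = P^* diag(d) P with P unitary, so the rows of P give the new basis *)
pose P := spectralmx A; pose d := spectral_diag A.
have PU : P \is unitarymx by exact: spectral_unitarymx.
have PP : P *m (P^T ^ (@Num.conj C))%sesqui = 1%:M by apply/unitarymxP.
have PP' : (P^T ^ (@Num.conj C))%sesqui *m P = 1%:M.
  by rewrite -invmx_unitary // mulVmx // unitarymx_unit.
have AE : P *m A *m (P^T ^ (@Num.conj C))%sesqui = diag_mx d.
  have A_eq : A = invmx P *m diag_mx d *m P.
    exact/orthomx_spectralP/hermitian_normalmx.
  rewrite A_eq invmx_unitary // !mulmxA PP mul1mx.
  by rewrite -mulmxA PP mulmx1.
pose f i := \sum_k P i k *: g k.
have fo : orthonormal_family f.
  move=> i j; have /matrixP/(_ i j) := PP; rewrite !mxE => <-.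
  rewrite /f (emb_sum (P j)) herm_sumr; apply: eq_bigr => k _ /=.
  by rewrite orthonormal_coef // !mxE mulrC.
have gf k : g k = \sum_i (P i k)^*%R *: f i.
  under eq_bigr do rewrite scaler_sumr.
  rewrite exchange_big /= (bigD1 k) //= [X in _ + X]big1 ?addr0.
    under eq_bigr do rewrite scalerA.
    rewrite -scaler_suml; have /matrixP/(_ k k) := PP'.
    by rewrite !mxE eqxx; under eq_bigr do rewrite !mxE; move=> ->; rewrite scale1r.
  move=> i ik; under eq_bigr do rewrite scalerA.
  rewrite -scaler_suml; have /matrixP/(_ k i) := PP'.
  rewrite !mxE eq_sym (negPf ik); under eq_bigr do rewrite !mxE.
  by move=> ->; rewrite scale0r.
exists n, f, (fun i => d 0 i); split; [split|..] => //.
- by move=> i; apply: rpred_sum => k _; apply: rpredZ.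
- move=> v vs; have vE : v = \sum_i (\sum_k p (e v) (e (g k)) * (P i k)^*%R) *: f i.
    rewrite {1}(gs v vs).
    transitivity (\sum_k \sum_i (p (e v) (e (g k)) * (P i k)^*%R) *: f i).
      apply: eq_bigr => k _; rewrite {2}gf scaler_sumr; apply: eq_bigr => i _.
      by rewrite scalerA.
    by rewrite exchange_big; apply: eq_bigr => i _ /=; rewrite scaler_suml.
  by rewrite /expands {1}vE; apply: eq_bigr => i _; rewrite {2}vE orthonormal_coef.
- move=> i j; have /matrixP/(_ i j) := AE; rewrite !mxE mulr_natr => <-.
  rewrite herm_sumr; apply: eq_bigr => k _; rewrite herm_suml !mxE mulrC.
  by congr (_ * _); apply: eq_bigr => k' _; rewrite !mxE.
- move=> i; have /hermitian_spectral_diag_real/mxOverP := Aherm; exact.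
Qed.

Lemma expands_form n (f : 'I_n -> T) (l : 'I_n -> C) (v : T) j :
  (forall i j, h (f i) (f j) = l i * (i == j)%:R) -> expands f v ->
  h v (f j) = l j * p (e v) (e (f j)).
Proof.
move=> hf {1}->; rewrite herm_suml (bigD1 j) //= hf eqxx mulr1 mulrC.
by rewrite big1 ?addr0 // => i /negPf ij; rewrite hf ij !mulr0.
Qed.

End SimultaneousDiagonalisation.

(** * Resolvents of matrices without real eigenvalues *)

Section ResolventBound.
Variable C : numClosedFieldType.

Lemma normC_ge_Im (z : C) : `|'Im z| <= `|z|.
Proof.
rewrite -(@ler_pXn2r _ 2) ?nnegrE // (normC2_Re_Im z).
by rewrite real_normK ?Creal_Im // lerDr -real_normK ?Creal_Re ?exprn_ge0.
Qed.

(** The distance from the real [t] to [z] is at least [|Im z|], which dominates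
    [1 + |z|] up to a constant, and [|t|] is at most [|z| + |t - z|]. *)
Lemma nonreal_root_bound (z : C) : z \isn't Num.real ->
  exists2 d : C, 0 < d
    & forall t, t \is Num.real -> d * (1 + `|t|) <= `|t - z|.
Proof.
move=> zr; have y0 : 0 < `|'Im z|.
  by rewrite normr_gt0; apply: contra zr => /eqP/Creal_ImP.
have c0 : 0 < (1 + `|z|) / `|'Im z| + 1.
  by rewrite addr_gt0 // divr_gt0 // ltr_wpDr.
exists ((1 + `|z|) / `|'Im z| + 1)^-1; first by rewrite invr_gt0.
move=> t tr; rewrite mulrC ler_pdivrMr // mulrDr mulr1.
have le1 : 1 + `|z| <= `|t - z| * ((1 + `|z|) / `|'Im z|).
  rewrite mulrCA ler_peMr ?addr_ge0 // ler_pdivlMr // mul1r.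
  have -> : 'Im z = - 'Im (t - z) by rewrite raddfB /= (Creal_ImP _ tr) sub0r opprK.
  by rewrite normrN normC_ge_Im.
have le2 : `|t| <= `|z| + `|t - z|.
  by rewrite -{1}(subrK z t) addrC ler_normD.
by apply: (le_trans (lerD (lexx 1) le2)); rewrite addrA lerD.
Qed.

Lemma nonreal_roots_bound (r : seq C) : (forall z, z \in r -> z \isn't Num.real) ->
  exists2 d : C, 0 < d & forall t, t \is Num.real ->
    d * (1 + `|t|) ^+ size r <= `|\prod_(z <- r) (t - z)|.
Proof.
elim: r => [|z r IH] rr.
  by exists 1 => // t _; rewrite big_nil expr0 mulr1 normr1.
have [|d d0 dP] := IH; first by move=> w wr; apply: rr; rewrite inE wr orbT.
have [d' d'0 d'P] := nonreal_root_bound (rr z (mem_head _ _)).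
exists (d' * d); first exact: mulr_gt0.
move=> t tr; rewrite big_cons normrM exprS mulrACA.
have t0 : 0 <= 1 + `|t| by rewrite addr_ge0.
by apply: ler_pM; rewrite ?d'P ?dP // mulr_ge0 ?exprn_ge0 // ltW.
Qed.

Lemma horner_char_poly n (N : 'M[C]_n) t : (char_poly N).[t] = \det (t%:M - N).
Proof.
rewrite /char_poly -[LHS]/(horner_eval t _) -det_map_mx; congr (\det _).
apply/matrixP => i j; rewrite !mxE.
by rewrite /= /horner_eval hornerD hornerN hornerC hornerMn hornerX.
Qed.

(** The determinant is the characteristic polynomial at [t]; it splits into [n]
    linear factors, and each of its roots is an eigenvalue, hence not real. *)
Lemma det_resolvent_bound n (N : 'M[C]_n) :
    (forall t, t \is Num.real -> t%:M - N \in unitmx) ->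
  exists2 d : C, 0 < d
    & forall t, t \is Num.real -> d * (1 + `|t|) ^+ n <= `|\det (t%:M - N)|.
Proof.
move=> NU; have [r] := closed_field_poly_normal (char_poly N).
rewrite (monicP (char_poly_monic N)) scale1r => cE.
have sr : size r = n.
  by have := size_char_poly N; rewrite cE size_prod_XsubC => -[].
have [z zr|d d0 dP] := @nonreal_roots_bound r.
  apply/negP => zreal; have := NU z zreal.
  rewrite unitmxE -horner_char_poly unitfE -[_ == 0]/(root _ z) cE.
  by rewrite root_prod_XsubC zr.
exists d => // t tr; rewrite -horner_char_poly cE horner_prod -sr.
by under eq_bigr do rewrite hornerXsubC; apply: dP.
Qed.

(** A cofactor is a signed sum of products of [n] entries, and each entry is
    [O(1 + |t|)]. *)
Lemma cofactor_bound n (N : 'M[C]_n.+1) :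
  exists2 K : C, 0 < K & forall t i j,
    `|cofactor (t%:M - N) i j| <= K * (1 + `|t|) ^+ n.
Proof.
pose B := 1 + \sum_i \sum_j `|N i j|.
have sB i j : `|N i j| <= \sum_i \sum_j `|N i j|.
  rewrite (bigD1 i) //= (bigD1 j) //= -addrA lerDl addr_ge0 //.
    exact: sumr_ge0.
  by apply: sumr_ge0 => k _; apply: sumr_ge0.
have B1 : 1 <= B.
  by rewrite lerDl; apply: sumr_ge0 => i _; apply: sumr_ge0.
have B0 : 0 < B by exact: lt_le_trans B1.
exists (#|{: 'S_n.+1}|%:R * B ^+ n).
  by rewrite mulr_gt0 ?exprn_gt0 // ltr0n; apply/card_gt0P; exists 1%g.
move=> t i j; rewrite expand_cofactor.
have t0 : 0 <= 1 + `|t| by rewrite addr_ge0.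
have entry k l : `|(t%:M - N) k l| <= B * (1 + `|t|).
  rewrite !mxE (le_trans (ler_normB _ _)) // mulrDr mulr1 addrC.
  apply: lerD; first by rewrite (le_trans (sB k l)) // lerDr.
  case: (k == l); rewrite ?mulr0n ?normr0 ?mulr1n.
    by rewrite ler_peMl.
  by rewrite mulr_ge0 // ltW.
apply: (le_trans (ler_norm_sum _ _ _)).
apply: (@le_trans _ _ (\sum_(s : 'S_n.+1) (B * (1 + `|t|)) ^+ n)); last first.
  by rewrite sumr_const -[leLHS]mulr_natl exprMn mulrA.
rewrite [leRHS](bigID (fun s : 'S_n.+1 => s i == j)) /=.
rewrite -[leLHS]addr0 lerD //; last first.
  by apply: sumr_ge0 => s _; rewrite exprn_ge0 // mulr_ge0 // ltW.
apply: ler_sum => s _; rewrite normrM normrX normrN1 expr1n mul1r normr_prod.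
apply: (@le_trans _ _ (\prod_(k | i != k) (B * (1 + `|t|)))).
  by apply: ler_prod => k _; rewrite normr_ge0 entry.
rewrite prodr_const; set c := #|_|; suff -> : c = n by [].
have -> : c = #|predC1 i| by apply: eq_card => k; rewrite !inE eq_sym.
by rewrite cardC1 card_ord.
Qed.

(** By Cramer's rule an entry of the resolvent is a quotient of a cofactor, whose
    degree in [t] is at most [n - 1], by a determinant of degree [n] without
    real roots. *)
Lemma resolvent_bound n (N : 'M[C]_n) :
    (forall t, t \is Num.real -> t%:M - N \in unitmx) ->
  exists2 K : C, 0 < K & forall t i j, t \is Num.real ->
    (1 + `|t|) * `|invmx (t%:M - N) i j| <= K.
Proof.
case: n N => [|n] N NU; first by exists 1 => // t [].
have [d d0 dP] := det_resolvent_bound NU.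
have [K K0 KP] := cofactor_bound N.
exists (K / d); first exact: divr_gt0.
move=> t i j tr; rewrite /invmx NU // !mxE normrM normfV.
have t0 : 0 < 1 + `|t| by rewrite ltr_wpDr.
have dt0 : 0 < `|\det (t%:M - N)|.
  by rewrite (lt_le_trans _ (dP t tr)) // mulr_gt0 // exprn_gt0.
rewrite mulrCA mulrC ler_pdivrMr // mulrAC ler_pdivlMr //.
apply: (@le_trans _ _ (K * (d * (1 + `|t|) ^+ n.+1))); last first.
  by rewrite ler_pM2l ?dP.
rewrite [d * _]mulrC mulrA ler_pM2r // exprS mulrCA.
by rewrite ler_pM2l.
Qed.

End ResolventBound.

(** * Real-valued norms and weighted square sums *)

Section RealNorm.
Variable R : realType.

Lemma rnormE (V : normedZmodType R[i]) (u : V) : (rnorm u)%:C = `|u|.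
Proof. by rewrite /rnorm RRe_real // ger0_real. Qed.

Lemma rnorm_ge0 (V : normedZmodType R[i]) (u : V) : 0 <= rnorm u.
Proof. by rewrite -ler0c rnormE. Qed.

Lemma rnorm0 (V : normedZmodType R[i]) : rnorm (0 : V) = 0.
Proof. by rewrite /rnorm normr0. Qed.

Lemma ler_rnormD (V : normedZmodType R[i]) (u v : V) :
  rnorm (u + v) <= rnorm u + rnorm v.
Proof. by rewrite -lecR rmorphD /= !rnormE ler_normD. Qed.

Lemma rnormM (y z : R[i]) : rnorm (y * z) = rnorm y * rnorm z.
Proof. by apply: complexI; rewrite rmorphM /= !rnormE normrM. Qed.

Lemma rnorm_real (t : R) : rnorm t%:C = `|t|.
Proof. by rewrite /rnorm normc_def /= expr0n addr0 sqrtr_sqr. Qed.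

Lemma ler_rnorm_sum (V : normedZmodType R[i]) n (f : 'I_n -> V) :
  rnorm (\sum_i f i) <= \sum_i rnorm (f i).
Proof.
elim: n f => [|n IH] f; first by rewrite !big_ord0 rnorm0.
by rewrite !big_ord_recl (le_trans (ler_rnormD _ _)) // lerD2l.
Qed.

Lemma rnorm_sqr (z : R[i]) : (rnorm z ^+ 2)%:C = z * (z^*)%R.
Proof. by rewrite rmorphXn /= rnormE normCK. Qed.

Lemma rnorm_pnorm m (V : normedZmodType R[i]) (U : 'I_m -> V) j :
  rnorm (U j) <= pnorm U.
Proof.
rewrite -[leLHS]ger0_norm ?rnorm_ge0 // -sqrtr_sqr ler_wsqrtr //.
by rewrite (bigD1 j) //= lerDl sumr_ge0 // => i _; rewrite sqr_ge0.
Qed.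

(** In orthonormal eigencoordinates the weight [1] gives the H0-norm, and the shifted
    eigenvalues as weights give the energy norm. *)
Definition wnorm n (w : 'I_n -> R) (a : 'I_n -> R[i]) : R :=
  Num.sqrt (\sum_l w l * rnorm (a l) ^+ 2).

Lemma sqr_wnorm n (w : 'I_n -> R) (a : 'I_n -> R[i]) : (forall l, 0 <= w l) ->
  wnorm w a ^+ 2 = \sum_l w l * rnorm (a l) ^+ 2.
Proof.
move=> w0; rewrite sqr_sqrtr // sumr_ge0 // => l _.
by rewrite mulr_ge0 ?sqr_ge0.
Qed.

Lemma wnorm_ge0 n (w : 'I_n -> R) a : 0 <= wnorm w a.
Proof. exact: sqrtr_ge0. Qed.

Lemma wnorm_zero n (w : 'I_n -> R) : wnorm w (fun=> 0) = 0.
Proof.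
by rewrite /wnorm big1 ?sqrtr0 // => l _; rewrite rnorm0 expr0n mulr0.
Qed.

Lemma eq_wnorm n (w : 'I_n -> R) a b : a =1 b -> wnorm w a = wnorm w b.
Proof.
by move=> ab; congr Num.sqrt; apply: eq_bigr => l _; rewrite ab.
Qed.

Lemma wnorm_triangle n (w : 'I_n -> R) (a b : 'I_n -> R[i]) :
    (forall l, 0 <= w l) ->
  wnorm w (fun l => a l + b l) <= wnorm w a + wnorm w b.
Proof.
move=> w0; set A := wnorm w a; set B := wnorm w b.
have [A0 B0] : 0 <= A /\ 0 <= B by rewrite !wnorm_ge0.
have zero (c : 'I_n -> R[i]) : wnorm w c = 0 -> forall l, w l * rnorm (c l) ^+ 2 = 0.
  move=> c0 l; have := sqr_wnorm c w0; rewrite c0 expr0n /= => /esym /psumr_eq0P.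
  by apply=> // i _; rewrite mulr_ge0 ?sqr_ge0.
pose x l := rnorm (a l); pose y l := rnorm (b l).
have x0 l : 0 <= x l by exact: rnorm_ge0.
have y0 l : 0 <= y l by exact: rnorm_ge0.
(* Cauchy-Schwarz: sum over l of w x y A B <= w (x^2 B^2 + y^2 A^2) / 2 *)
have cs : \sum_l w l * (x l * y l) <= A * B.
  have [AB|AB] := eqVneq (A * B) 0.
    rewrite AB big1 // => l _; apply/eqP; move/eqP: AB.
    rewrite mulf_eq0 => /orP[] /eqP /zero /(_ l) /eqP; rewrite mulf_eq0 expf_eq0 /=.
      by case/orP => [/eqP ->|]; rewrite ?mul0r // /x => /eqP ->; rewrite mul0r mulr0.
    by case/orP => [/eqP ->|]; rewrite ?mul0r // /y => /eqP ->; rewrite !mulr0.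
  have ABp : 0 < A * B by rewrite lt_def AB mulr_ge0.
  rewrite -(ler_pM2r ABp) mulr_suml.
  have -> : A * B * (A * B) = ((\sum_l w l * x l ^+ 2) * B ^+ 2
      + A ^+ 2 * (\sum_l w l * y l ^+ 2)) / 2.
    by rewrite -(sqr_wnorm a w0) -(sqr_wnorm b w0) -/A -/B; field.
  rewrite mulr_suml mulr_sumr -big_split /= mulr_suml.
  apply: ler_sum => l _; have := mulr_ge0 (w0 l) (sqr_ge0 (x l * B - y l * A)); lra.
rewrite -(@ler_pXn2r _ 2) ?nnegrE ?wnorm_ge0 ?addr_ge0 //.
rewrite sqrrD /A /B !sqr_wnorm // -/A -/B.
apply: (@le_trans _ _ (\sum_l (w l * x l ^+ 2 + (w l * (x l * y l) + w l * (x l * y l)) + w l * y l ^+ 2))).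
  apply: ler_sum => l _; rewrite [leRHS](_ : _ = w l * (x l + y l) ^+ 2); last by ring.
  rewrite ler_wpM2l //.
  by rewrite ler_pXn2r ?nnegrE ?addr_ge0 ?rnorm_ge0 // ler_rnormD.
by rewrite !big_split /= lerD2r lerD2l mulr2n lerD.
Qed.

Lemma wnorm_sum n m (w : 'I_n -> R) (a : 'I_m -> 'I_n -> R[i]) :
    (forall l, 0 <= w l) ->
  wnorm w (fun l => \sum_j a j l) <= \sum_j wnorm w (a j).
Proof.
move=> w0; elim: m a => [|m IH] a.
  rewrite big_ord0 -(wnorm_zero w) (@eq_wnorm _ _ _ (fun=> 0)) // => l.
  by rewrite big_ord0.
rewrite big_ord_recl.
rewrite (eq_wnorm _ (fun l => big_ord_recl _ (fun j => a j l))).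
by apply: (le_trans (wnorm_triangle _ _ w0)); rewrite lerD2l IH.
Qed.

Lemma wnorm_mul n (v w : 'I_n -> R) (r a : 'I_n -> R[i]) (D : R) : 0 <= D ->
    (forall l, 0 <= v l) -> (forall l, w l * rnorm (r l) ^+ 2 <= D ^+ 2 * v l) ->
  wnorm w (fun l => r l * a l) <= D * wnorm v a.
Proof.
move=> D0 v0 le; have -> : D * wnorm v a =
    Num.sqrt (\sum_l D ^+ 2 * v l * rnorm (a l) ^+ 2).
  rewrite -{1}(ger0_norm D0) -sqrtr_sqr -sqrtrM ?sqr_ge0 //.
  by rewrite mulr_sumr; under eq_bigr do rewrite mulrA.
apply/ler_wsqrtr/ler_sum => l _; rewrite rnormM exprMn mulrA.
by rewrite ler_wpM2r ?sqr_ge0.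
Qed.

Lemma ler_wnorm n (w v : 'I_n -> R) (a b : 'I_n -> R[i]) :
  (forall l, w l * rnorm (a l) ^+ 2 <= v l * rnorm (b l) ^+ 2) ->
  wnorm w a <= wnorm v b.
Proof. by move=> le; apply/ler_wsqrtr/ler_sum => l _. Qed.

End RealNorm.

(** * The scheme on one eigenvector *)

(** The algebra is done over a field with a square root [w] of -1.  At [z = - w t] the
    matrix [1 - z A] is [w A (t - N)], so the stability function is expressed by the
    resolvent of [N = w A^-1]. *)
Section StabilityFunctionAsResolvent.
Variables (F : fieldType) (n : nat) (w t : F) (A Ai : 'M[F]_n).
Hypotheses (ww : w * w = -1) (AAi : A *m Ai = 1%:M).
Let N := w *: Ai.

Lemma stab_mx_factor : (w *: A) *m (t%:M - N) = 1%:M - (- (w * t)) *: A.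
Proof.
rewrite mulmxBr mul_mx_scalar -scalemxAl -scalemxAr AAi !scalerA ww mulrC.
by rewrite scaleN1r opprK scaleNr opprK addrC.
Qed.

Lemma invmx_stab_mx : 1%:M - (- (w * t)) *: A \in unitmx ->
  invmx (1%:M - (- (w * t)) *: A) = - (invmx (t%:M - N) *m N).
Proof.
move=> SU; have := SU; rewrite -{1}stab_mx_factor unitmx_mul => /andP[_ U].
have AiA : Ai *m A = 1%:M by exact: mulmx1C.
have E : - (invmx (t%:M - N) *m N) *m (1%:M - (- (w * t)) *: A) = 1%:M.
  rewrite -stab_mx_factor mulNmx mulmxA -[_ *m N *m _]mulmxA.
  rewrite -scalemxAl -[Ai *m _]scalemxAr AiA scalerA ww scaleN1r mulmxN mulmx1.
  by rewrite mulNmx opprK mulVmx.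
by apply: (can_inj (mulmxK SU)); rewrite mulVmx // E.
Qed.

Lemma stab_fun_as_resolvent (b : 'rV[F]_n) (u : 'cV[F]_n) :
    1%:M - (- (w * t)) *: A \in unitmx ->
  1 + - (w * t) * (b *m invmx (1%:M - (- (w * t)) *: A) *m u) 0 0 =
  1 - (b *m Ai *m u) 0 0
    + (b *m Ai *m invmx (t%:M - N) *m - (N *m u)) 0 0.
Proof.
move=> SU; have := SU; rewrite -{1}stab_mx_factor unitmx_mul => /andP[_ U].
rewrite invmx_stab_mx //; set V := invmx _.
have NV : N *m V = t *: V - 1%:M.
  rewrite -[X in N *m X]/V -{1}[N](subKr t%:M) mulmxBl mulmxV //.
  by rewrite mul_scalar_mx.
have AiE : Ai = - w *: N by rewrite /N scalerA mulNr ww opprK scale1r.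
have AiVN : Ai *m V *m N = - ((w * t) *: (V *m N)) - Ai.
  have -> : Ai *m V *m N = - w *: (N *m V *m N).
    by rewrite {1}AiE -(scalemxAl (- w) N) -(scalemxAl (- w) (N *m V)).
  rewrite NV mulmxBl mul1mx -(scalemxAl t) scalerBr scalerA -AiE.
  by rewrite mulNr scaleNr.
have -> : b *m Ai *m V *m - (N *m u) = b *m (- (Ai *m V *m N)) *m u.
  by rewrite !(mulmxN, mulNmx, mulmxA).
rewrite AiVN opprD !opprK mulmxDr mulmxDl -(scalemxAr (w * t)) -(scalemxAl (w * t)).
rewrite mulmxN mulNmx !mxE.
by rewrite mulrNN addrCA subrK addrC.
Qed.

End StabilityFunctionAsResolvent.

Section ScalarScheme.
Variables (R : realType) (m : nat) (rk : rk_method R m).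
Hypotheses (rk_stable : A_stable rk) (rkA_inv : rkA rk \in unitmx).
Local Notation toC := (map_mx (real_complex R)).
Local Notation N := (rk_iAinv rk).

(** The response of the new value of the solution to the right-hand side, for the
    eigenvalue [t] of [k] times the Hermitian form. *)
Definition rk_response (t : R[i]) : 'rV[R[i]]_m :=
  rk_bAinv rk *m invmx (t%:M - N).

Lemma toC_rkAV : toC (rkA rk) *m toC (invmx (rkA rk)) = 1%:M.
Proof. by rewrite -map_mxM mulmxV // map_mx1. Qed.

Lemma mul_ii : 'i%C * 'i%C = -1 :> R[i].
Proof. by rewrite -expr2 sqr_i. Qed.

Lemma opp_mul_i_real (t : R) : - ('i%C * t%:C) = (- t) *i.
Proof. by simpc. Qed.

Lemma stab_mx_unit (t : R) :
  1%:M - (- ('i%C * t%:C)) *: toC (rkA rk) \in unitmx.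
Proof. by rewrite opp_mul_i_real; case: (rk_stable (z := (- t) *i)). Qed.

Lemma resolvent_unit (t : R) : t%:C%:M - N \in unitmx.
Proof.
have := stab_mx_unit t.
by rewrite -(stab_mx_factor _ mul_ii toC_rkAV) unitmx_mul => /andP[].
Qed.

Lemma stab_fun_response (t : R) :
  stab_fun rk ((- t) *i) =
    (stab_infty rk)%:C + (rk_response t%:C *m rk_d rk) 0 0.
Proof.
have := stab_fun_as_resolvent mul_ii toC_rkAV (toC (rkb rk)^T) (const_mx 1)
  (stab_mx_unit t).
rewrite opp_mul_i_real /stab_fun /stab_mx map_trmx => ->.
rewrite /rk_response /rk_d /rk_bAinv map_mxM; congr (_ + _).
rewrite /stab_infty rmorphB rmorph1 -map_mxM; congr (_ - _).
by rewrite -[const_mx 1](map_const_mx (real_complex R)) -map_mxM mxE.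
Qed.

(** Eliminating the stages: the old value is multiplied by the stability function on
    the imaginary axis. *)
Lemma scalar_step (t : R) (xi : R[i]) (Y f : 'cV[R[i]]_m) :
    (t%:C%:M - N) *m Y = xi *: rk_d rk + f ->
  (stab_infty rk)%:C * xi + (rk_bAinv rk *m Y) 0 0 =
    stab_fun rk ((- t) *i) * xi + \sum_j rk_response t%:C 0 j * f j 0.
Proof.
move=> eqY; have U := resolvent_unit t.
have -> : Y = invmx (t%:C%:M - N) *m (xi *: rk_d rk + f).
  by rewrite -eqY mulKmx.
rewrite stab_fun_response mulrDl -addrA; congr (_ + _).
rewrite mulmxA -/(rk_response t%:C) mulmxDr [LHS]mxE; congr (_ + _).
  by rewrite -(scalemxAr xi) mxE mulrC.
by rewrite mxE.
Qed.

(** The decay in [t] comes from the resolvent: A-stability excludes real eigenvalues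
    of [i A^-1]. *)
Lemma rk_response_bound : exists2 K : R, 0 < K & forall t j,
  (1 + `|t|) * rnorm (rk_response t%:C 0 j) <= K.
Proof.
have [|K K0 KP] := @resolvent_bound _ m N.
  by move=> t tr; rewrite -(RRe_real tr); exact: resolvent_unit.
pose B := \sum_i rnorm (rk_bAinv rk 0 i).
have B0 : 0 <= B by apply: sumr_ge0 => i _; apply: rnorm_ge0.
exists (1 + B * rnorm K).
  by rewrite ltr_pwDl // mulr_ge0 ?rnorm_ge0.
move=> t j; apply: (@le_trans _ _ (B * rnorm K)); last by rewrite lerDr.
rewrite mxE mulrC /B mulr_suml.
apply: (@le_trans _ _ (\sum_i rnorm (rk_bAinv rk 0 i)
    * ((1 + `|t|) * rnorm (invmx (t%:C%:M - N) i j)))).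
  apply: (le_trans (ler_wpM2r _ (ler_rnorm_sum _))); first by rewrite addr_ge0.
  by rewrite mulr_suml ler_sum // => i _; rewrite rnormM mulrAC mulrA.
apply: ler_sum => i _; rewrite ler_wpM2l ?rnorm_ge0 //.
rewrite -lecR rmorphM rmorphD rmorph1 /= -(rnorm_real t) !rnormE.
by rewrite (ger0_norm (ltW K0)) KP // complex_real.
Qed.

End ScalarScheme.

(** * One step of the scheme in eigencoordinates *)

Section Eigencoordinates.
Variables (R : realType) (S : setting R).

Definition eigenfamily n (f : 'I_n -> H1 S) (lam : 'I_n -> R) : Prop :=
  orthonormal_family (emb S) inner f /\
  forall i j, hform S (f i) (f j) = (lam i)%:C * (i == j)%:R.

(** The vector [g] may lie outside the span of [f]; for the general right-hand sides
    these are the coordinates of the H0-projection. *)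
Definition coord n (f : 'I_n -> H1 S) (g : H0 S) (l : 'I_n) : R[i] :=
  inner g (emb S (f l)).

Definition spanned n (f : 'I_n -> H1 S) (u : H1 S) : Prop :=
  expands (emb S) inner f u.

Lemma eigenfamily_exists (s : seq (H1 S)) : {subset s <= Hh S} ->
  exists n (f : 'I_n -> H1 S) lam, [/\ eigenfamily f lam,
    forall l, f l \in Hh S & forall u, u \in s -> spanned f u].
Proof.
move=> sH; have [n [f [lam [[fH fo fs] fl lr]]]] :=
  simultaneous_diagonalisation (@emb_inj _ S) inner (hform S) sH.
exists n, f, (fun l => complex.Re (lam l)); split=> //; split=> // i j.
by rewrite RRe_real.
Qed.

Variables (n : nat) (f : 'I_n -> H1 S) (lam : 'I_n -> R).
Hypothesis eig : eigenfamily f lam.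

Lemma inner_eigen_sum (a : 'I_n -> R[i]) g :
  inner (emb S (\sum_l a l *: f l)) g = \sum_l a l * (coord f g l)^*%R.
Proof.
rewrite emb_sum herm_suml; apply: eq_bigr => l _.
by rewrite hermJ.
Qed.

Lemma inner_spanned u g : spanned f u ->
  inner (emb S u) g = \sum_l coord f (emb S u) l * (coord f g l)^*%R.
Proof. by move=> {1}->; rewrite inner_eigen_sum. Qed.

Lemma hform_eigen u l : spanned f u ->
  hform S u (f l) = (lam l)%:C * coord f (emb S u) l.
Proof. by case: eig => fo fl us; exact: (expands_form _ fl us). Qed.

Lemma hform_spanned u : spanned f u ->
  hform S u u = (\sum_l lam l * rnorm (coord f (emb S u) l) ^+ 2)%:C.
Proof.
move=> us; rewrite {1}us herm_suml rmorph_sum; apply: eq_bigr => l _ /=.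
rewrite hermJ hform_eigen // rmorphM rmorphM /= rnorm_sqr mulrCA; congr (_ * _).
by rewrite conj_Creal // complex_real.
Qed.

Lemma inner_rnorm (g : H0 S) : inner g g = (rnorm g ^+ 2)%:C.
Proof. by rewrite inner_norm rmorphXn /= rnormE. Qed.

Lemma rnorm_emb_spanned u : spanned f u ->
  rnorm (emb S u) = wnorm (fun=> 1) (coord f (emb S u)).
Proof.
move=> us; rewrite -[LHS]ger0_norm ?rnorm_ge0 // -sqrtr_sqr; congr Num.sqrt.
apply: complexI; rewrite -inner_rnorm inner_spanned // rmorph_sum.
by apply: eq_bigr => l _; rewrite /= mul1r rnorm_sqr.
Qed.

(** Bessel's inequality: expand the squared norm of [g] minus its projection [v]. *)
Lemma coord_bessel g : wnorm (fun=> 1) (coord f g) <= rnorm g.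
Proof.
rewrite -[leRHS]ger0_norm ?rnorm_ge0 // -sqrtr_sqr ler_wsqrtr //.
set B := \sum_l _.
have BE : B%:C = \sum_l coord f g l * (coord f g l)^*%R.
  rewrite /B rmorph_sum; apply: eq_bigr => l _.
  by rewrite /= mul1r rnorm_sqr.
pose v := emb S (\sum_l coord f g l *: f l).
have vg : inner v g = B%:C by rewrite inner_eigen_sum.
have gv : inner g v = B%:C by rewrite hermJ /= vg conj_Creal // complex_real.
have vv : inner v v = B%:C.
  rewrite inner_eigen_sum BE; apply: eq_bigr => l _; congr (_ * _^*%R).
  by case: eig => fo _; exact: orthonormal_coef.
have : 0 <= inner (g - v) (g - v) by rewrite inner_norm exprn_ge0.
rewrite linearBl linearBr /= linearBr /= vg gv vv subrr subr0 inner_rnorm.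
by rewrite -rmorphB ler0c subr_ge0.
Qed.

Lemma stab_form_spanned u : spanned f u -> stab_form u u =
  (\sum_l (lam l + alpha S) * rnorm (coord f (emb S u) l) ^+ 2)%:C.
Proof.
move=> us; rewrite /stab_form hform_spanned // inner_rnorm rnorm_emb_spanned //.
rewrite sqr_wnorm // -rmorphM -rmorphD; congr (_%:C).
rewrite mulr_sumr -big_split; apply: eq_bigr => l _ /=.
by rewrite mul1r mulrDl.
Qed.

Lemma stab_form_eigen l : stab_form (f l) (f l) = (lam l + alpha S)%:C.
Proof.
by case: eig => fo fl; rewrite /stab_form fl fo eqxx !mulr1 -rmorphD.
Qed.

End Eigencoordinates.

Section EigenStep.
Variables (R : realType) (m : nat) (rk : rk_method R m) (S : setting R) (k : R).
Hypotheses (rk_stable : A_stable rk) (rkA_inv : rkA rk \in unitmx).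
Variables (x x' : H1 S) (X : 'I_m -> H1 S) (F : 'I_m -> H0 S).
Hypothesis stages : forall V : 'I_m -> H1 S, in_Hh V ->
  rk_form rk k X V = pinner (fun i => rk_d rk i 0 *: emb S x) (pemb V)
    + pinner F (pemb V).
Hypothesis update : x' = (stab_infty rk)%:C *: x + mxact (rk_bAinv rk) X 0.

Section Coordinates.
Variables (n : nat) (f : 'I_n -> H1 S) (lam : 'I_n -> R).
Hypotheses (eig : eigenfamily f lam) (fH : forall l, f l \in Hh S).
Hypothesis X_spanned : forall j, spanned f (X j).

Lemma pinner_single (U : 'I_m -> H0 S) j v :
  pinner U (pemb (fun i => if i == j then v else 0)) = inner (U j) (emb S v).
Proof.
rewrite /pinner (bigD1 j) //= /pemb eqxx big1 ?addr0 // => i /negPf ->.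
by rewrite linear0 linear0r.
Qed.

Lemma pform_single (U : 'I_m -> H1 S) j v :
  pform U (fun i => if i == j then v else 0) = hform S (U j) v.
Proof.
rewrite /pform (bigD1 j) //= eqxx big1 ?addr0 // => i /negPf ->.
by rewrite linear0r.
Qed.

(** The test function is [f l] in stage [j] and zero in the other stages. *)
Lemma stage_coord l :
  ((k * lam l)%:C%:M - rk_iAinv rk) *m (\col_j coord f (emb S (X j)) l)
    = coord f (emb S x) l *: rk_d rk + \col_j coord f (F j) l.
Proof.
apply/matrixP => j z; rewrite (ord1 z) {z}.
have Vh : in_Hh (fun i : 'I_m => if i == j then f l else 0).
  by move=> i; case: ifP => _; rewrite ?fH // rpred0.
have := stages Vh; rewrite /rk_form !pinner_single pform_single.
rewrite (hform_eigen eig) // /mxact herm_suml linearZl_LR /= => stage.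
have -> : (coord f (emb S x) l *: rk_d rk + \col_j coord f (F j) l) j 0
    = rk_d rk j 0 * coord f (emb S x) l + coord f (F j) l.
  by rewrite [LHS]mxE [X in X + _]mxE [X in _ + X]mxE mulrC.
rewrite -[RHS]stage mulmxBl mul_scalar_mx !mxE addrC.
rewrite rmorphM -mulrA /=; congr (- _ + _).
by apply: eq_bigr => i _; congr (_ * _); rewrite mxE.
Qed.

Lemma coord_step l : coord f (emb S x') l =
  stab_fun rk ((- (k * lam l)) *i) * coord f (emb S x) l
    + \sum_j rk_response rk (k * lam l)%:C 0 j * coord f (F j) l.
Proof.
have := scalar_step rk_stable rkA_inv (stage_coord l).
under eq_bigr do rewrite mxE; move=> <-.
have -> : emb S x' = (stab_infty rk)%:C *: emb S x
    + \sum_j rk_bAinv rk 0 j *: emb S (X j).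
  by rewrite update linearD linearZ /mxact emb_sum.
rewrite /coord linearDl linearZl_LR /= herm_suml [X in _ = _ + X]mxE.
by congr (_ + _); apply: eq_bigr => j _; congr (_ * _); rewrite mxE.
Qed.

End Coordinates.

Hypotheses (xH : x \in Hh S) (x'H : x' \in Hh S) (XH : in_Hh X).

(** The vectors [E] are the discrete part of the data: including them in the span
    makes their energy norm readable from the coordinates, too. *)
Lemma eigen_step (E : 'I_m -> H1 S) : in_Hh E ->
  exists n (f : 'I_n -> H1 S) lam, [/\ eigenfamily f lam,
    [/\ spanned f x, spanned f x' & forall j, spanned f (E j)]
  & forall l, coord f (emb S x') l =
      stab_fun rk ((- (k * lam l)) *i) * coord f (emb S x) l
        + \sum_j rk_response rk (k * lam l)%:C 0 j * coord f (F j) l].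
Proof.
move=> EH.
have [|n [f [lam [eig fH fs]]]] := @eigenfamily_exists R S
    ([:: x, x' & codom X] ++ codom E).
  move=> u; rewrite mem_cat !inE => /orP[/or3P[/eqP->|/eqP->|]|] //.
    by move=> /codomP[j ->]; apply: XH.
  by move=> /codomP[j ->]; apply: EH.
have sX j : spanned f (X j).
  by apply: fs; rewrite mem_cat !inE codom_f !orbT.
exists n, f, lam; split=> //; last exact: coord_step.
split; first by apply: fs; rewrite mem_cat !inE eqxx.
  by apply: fs; rewrite mem_cat !inE eqxx !orbT.
by move=> j; apply: fs; rewrite mem_cat codom_f orbT.
Qed.

End EigenStep.

(** * Estimates for one step *)

Section OneStep.
Variables (R : realType) (m : nat) (rk : rk_method R m).
Hypotheses (rk_stable : A_stable rk) (rkA_inv : rkA rk \in unitmx).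

Lemma stab_fun_imag_le1 (t : R) : rnorm (stab_fun rk ((- t) *i)) <= 1.
Proof. by case: (rk_stable (z := (- t) *i)). Qed.

Variable K : R.
Hypothesis responseP :
  forall t j, (1 + `|t|) * rnorm (rk_response rk t%:C 0 j) <= K.

Lemma response_const_ge0 (j : 'I_m) : 0 <= K.
Proof.
by apply: le_trans (responseP 0 j); rewrite mulr_ge0 ?rnorm_ge0 ?addr_ge0.
Qed.

(** The decay of the response lets the weight [w] exceed [v] by a factor of order
    [(1 + |t|)^2]. *)
Lemma wnorm_response n (w v : 'I_n -> R) (t : 'I_n -> R) (c : 'I_n -> R[i]) j D :
    (forall l, 0 <= w l) -> (forall l, 0 <= v l) -> 0 <= D ->
    (forall l, w l <= D ^+ 2 * v l * (1 + `|t l|) ^+ 2) ->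
  wnorm w (fun l => rk_response rk (t l)%:C 0 j * c l) <= K * D * wnorm v c.
Proof.
move=> w0 v0 D0 wv; have K0 := response_const_ge0 j.
apply: wnorm_mul => // [|l]; first exact: mulr_ge0.
set r := rnorm _; have r0 : 0 <= r by exact: rnorm_ge0.
apply: (le_trans (ler_wpM2r (sqr_ge0 r) (wv l))).
rewrite -[leLHS]mulrA [(K * D) ^+ 2]exprMn -(mulrA (K ^+ 2)) (mulrC (K ^+ 2)).
rewrite ler_wpM2l ?mulr_ge0 ?sqr_ge0 // -exprMn.
by rewrite ler_pXn2r ?nnegrE ?responseP // mulr_ge0 ?addr_ge0.
Qed.

Lemma wnorm_step n (w : 'I_n -> R) (t : 'I_n -> R) (a a' : 'I_n -> R[i])
    (c : 'I_m -> 'I_n -> R[i]) : (forall l, 0 <= w l) ->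
    (forall l, a' l = stab_fun rk ((- t l) *i) * a l
      + \sum_j rk_response rk (t l)%:C 0 j * c j l) ->
  wnorm w a' <= wnorm w a
    + \sum_j wnorm w (fun l => rk_response rk (t l)%:C 0 j * c j l).
Proof.
move=> w0 a'E; rewrite (eq_wnorm w a'E).
apply: (le_trans (wnorm_triangle _ _ w0)); apply: lerD (wnorm_sum _ w0).
apply: ler_wnorm => l; rewrite ler_wpM2l // rnormM exprMn ler_piMl ?sqr_ge0 //.
by rewrite expr_le1 ?rnorm_ge0 ?stab_fun_imag_le1.
Qed.

(** With [m.+1] instead of [m] the constants of the theorem are positive even for
    [m = 0]. *)
Lemma ler_sum_const (g : 'I_m -> R) D : (forall j, g j <= D) -> 0 <= D ->
  \sum_j g j <= m.+1%:R * D.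
Proof.
move=> gD D0; apply: (@le_trans _ _ (\sum_(j < m) D)); first exact: ler_sum.
by rewrite sumr_const card_ord -[leLHS]mulr_natl ler_wpM2r // ler_nat.
Qed.

Variables (S : setting R) (k : R) (F : nat -> 'I_m -> H0 S).
Variables (x : nat -> H1 S) (X : nat -> 'I_m -> H1 S).
Hypotheses (k0 : 0 < k) (sol : rk_solution rk k F x X).

Lemma pnorm_ge0 (V : normedZmodType R[i]) (U : 'I_m -> V) : 0 <= pnorm U.
Proof. exact: sqrtr_ge0. Qed.

Lemma solution_eigen_step i (E : 'I_m -> H1 S) : in_Hh E ->
  exists n (f : 'I_n -> H1 S) lam, [/\ eigenfamily f lam,
    [/\ spanned f (x i), spanned f (x i.+1) & forall j, spanned f (E j)]
  & forall l, coord f (emb S (x i.+1)) l =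
      stab_fun rk ((- (k * lam l)) *i) * coord f (emb S (x i)) l
        + \sum_j rk_response rk (k * lam l)%:C 0 j * coord f (F i j) l].
Proof.
have [xH XH stages upd] := sol i; have [x'H _ _ _] := sol i.+1.
exact: (eigen_step rk_stable rkA_inv stages upd).
Qed.

(** With weight [1] the response is bounded by [K], and Bessel's inequality bounds the
    coordinates of [F i], which lies in H0 only. *)
Lemma H0_step i : 0 <= K ->
  rnorm (emb S (x i.+1)) <= rnorm (emb S (x i)) + m.+1%:R * K * pnorm (F i).
Proof.
move=> K0; have [|n [f [lam [eig [sx sx' _] cE]]]] :=
  @solution_eigen_step i (fun=> 0); first by move=> j; rewrite rpred0.
rewrite (rnorm_emb_spanned sx) (rnorm_emb_spanned sx').
apply: (le_trans (wnorm_step _ cE)) => //; rewrite lerD2l -mulrA.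
apply: ler_sum_const => [j|]; last by rewrite mulr_ge0 ?pnorm_ge0.
apply: (@le_trans _ _ (K * 1 * wnorm (fun=> 1) (coord f (F i j)))).
  apply: wnorm_response => // l.
  by rewrite expr1n !mul1r expr_ge1 ?addr_ge0 // lerDl.
rewrite mulr1 ler_wpM2l //.
exact: le_trans (coord_bessel eig _) (rnorm_pnorm _ _).
Qed.

Definition energy_norm (u : H1 S) : R := Num.sqrt (complex.Re (stab_form u u)).

Lemma energy_norm_spanned n (f : 'I_n -> H1 S) lam u :
  eigenfamily f lam -> spanned f u ->
  energy_norm u = wnorm (fun l => lam l + alpha S) (coord f (emb S u)).
Proof. by move=> eig su; rewrite /energy_norm (stab_form_spanned eig). Qed.

Lemma energy_norm_ub M u : stab_form_bound S M ->
  energy_norm u <= Num.sqrt `|M| * rnorm u.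
Proof.
move=> Mb; rewrite -[rnorm u]ger0_norm ?rnorm_ge0 // -(sqrtr_sqr (rnorm u)) -sqrtrM //.
apply: ler_wsqrtr; apply: (@le_trans _ _ (rnorm (stab_form u u))).
  rewrite -lecR rnormE; apply: le_trans (normc_ge_Re _).
  by rewrite lecR ler_norm.
by apply: (le_trans (Mb u u)); rewrite -expr2 ler_wpM2r ?sqr_ge0 ?ler_norm.
Qed.

Hypothesis S_ell : elliptic S.

Lemma energy_norm_lb u : Num.sqrt (beta S) * rnorm u <= energy_norm u.
Proof.
rewrite -[rnorm u]ger0_norm ?rnorm_ge0 // -(sqrtr_sqr (rnorm u)) -sqrtrM.
  by apply: ler_wsqrtr; apply: S_ell.
exact: ltW (beta_gt0 S).
Qed.

Lemma eigen_weight_ge0 n (f : 'I_n -> H1 S) lam l :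
  eigenfamily f lam -> 0 <= lam l + alpha S.
Proof.
move=> eig; have := S_ell (f l); rewrite (stab_form_eigen eig) /=.
by apply: le_trans; rewrite mulr_ge0 ?sqr_ge0 // (ltW (beta_gt0 S)).
Qed.

(** The part [W] of the data has an energy norm of its own, so there the response is
    applied with equal weights.  The remainder only has an H0-norm; for it the decay
    of the response compensates the weight, by
    [k (lam + alpha) <= |t| + K2 <= (1 + K2) (1 + |t|)^2] with [t = k lam]. *)
Lemma energy_step i (M K2 : R) (W : 'I_m -> H1 S) :
    0 <= K -> stab_form_bound S M -> k * alpha S <= K2 -> in_Hh W ->
  energy_norm (x i.+1) <= energy_norm (x i)
    + m.+1%:R * (K * Num.sqrt `|M| * pnorm W
      + K * Num.sqrt (1 + K2) * ((Num.sqrt k)^-1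
          * pnorm (fun j => F i j - emb S (W j)))).
Proof.
move=> K0 Mb kK2 WH; have [n [f [lam [eig [sx sx' sW] cE]]]] :=
  solution_eigen_step i WH.
have K20 : 0 <= K2.
  by apply: le_trans kK2; rewrite mulr_ge0 ?(ltW k0) // (ltW (alpha_gt0 S)).
have w0 l : 0 <= lam l + alpha S by exact: (eigen_weight_ge0 l eig).
rewrite !(energy_norm_spanned eig) //.
apply: (le_trans (wnorm_step _ cE)) => //; rewrite lerD2l.
apply: ler_sum_const => [j|]; last first.
  by rewrite addr_ge0 ?mulr_ge0 ?invr_ge0 ?sqrtr_ge0 ?pnorm_ge0.
set w := fun l => _.
set G := fun j => F i j - _; set r := fun l => rk_response rk (k * lam l)%:C 0 j.
rewrite (@eq_wnorm _ _ _ _ (fun l => r l * coord f (emb S (W j)) l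
    + r l * coord f (G j) l)); last first.
  by move=> l; rewrite /G /coord linearBl /= -mulrDr addrC subrK.
apply: (le_trans (wnorm_triangle _ _ w0)); apply: lerD.
  apply: (@le_trans _ _ (K * 1 * wnorm w (coord f (emb S (W j))))).
    apply: wnorm_response => // l; rewrite expr1n mul1r ler_peMr //.
    by rewrite expr_ge1 ?addr_ge0 // lerDl.
  rewrite mulr1 -mulrA ler_wpM2l // -(energy_norm_spanned eig) //.
  by apply: (le_trans (energy_norm_ub _ Mb)); rewrite ler_wpM2l ?rnorm_pnorm.
pose D := Num.sqrt (1 + K2) * (Num.sqrt k)^-1.
apply: (@le_trans _ _ (K * D * wnorm (fun=> 1) (coord f (G j)))).
  apply: wnorm_response => // [|l].
    by rewrite /D mulr_ge0 ?invr_ge0 ?sqrtr_ge0.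
  rewrite /D exprMn exprVn !sqr_sqrtr ?(ltW k0) ?addr_ge0 // mulr1.
  rewrite mulrAC ler_pdivlMr // /w mulrDl [lam l * k]mulrC [alpha S * k]mulrC.
  set s := k * lam l; have := ler_norm s; have s0 := normr_ge0 s.
  have := mulr_ge0 K20 s0; have := mulr_ge0 K20 (sqr_ge0 `|s|).
  have := sqr_ge0 `|s|; nra.
rewrite /D !mulrA ler_wpM2l ?mulr_ge0 ?invr_ge0 ?sqrtr_ge0 //.
exact: le_trans (coord_bessel eig _) (rnorm_pnorm G j).
Qed.

End OneStep.

(** * The evolution over many steps *)

Lemma ler_telescope (R : realType) (e g : nat -> R) :
  (forall n, e n.+1 <= e n + g n) -> forall n, e n <= e 0%N + \sum_(j < n) g j.
Proof.
move=> eg; elim=> [|n IH]; first by rewrite big_ord0 addr0.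
by apply: (le_trans (eg n)); rewrite big_ord_recr addrA lerD2r.
Qed.

Lemma conserved_step (R : realType) (m : nat) (rk : rk_method R m)
    (rk_stable : A_stable rk) (rkA_inv : rkA rk \in unitmx)
    (S : setting R) (k : R) (x : nat -> H1 S) (X : nat -> 'I_m -> H1 S) :
    (forall t : R, rnorm (stab_fun rk (t *i)) = 1) ->
    rk_solution rk k (fun _ _ => 0) x X -> forall i,
  rnorm (emb S (x i.+1)) = rnorm (emb S (x i)) /\
  hform S (x i.+1) (x i.+1) = hform S (x i) (x i).
Proof.
move=> unimod sol i.
have [|n [f [lam [eig [sx sx' _] cE]]]] :=
  solution_eigen_step rk_stable rkA_inv sol i (E := fun=> 0).
  by move=> j; rewrite rpred0.
have cN l : rnorm (coord f (emb S (x i.+1)) l) = rnorm (coord f (emb S (x i)) l).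
  rewrite cE big1 ?addr0 => [|j _]; first by rewrite rnormM unimod mul1r.
  by rewrite /coord linear0l mulr0.
split.
  rewrite (rnorm_emb_spanned sx) (rnorm_emb_spanned sx'); congr Num.sqrt.
  by apply: eq_bigr => l _; rewrite cN.
rewrite (hform_spanned eig sx) (hform_spanned eig sx'); congr (_%:C).
by apply: eq_bigr => l _; rewrite cN.
Qed.

Section EnergyEstimate.
Variables (R : realType) (S : setting R) (x : nat -> H1 S) (M D : R).
Hypotheses (S_ell : elliptic S) (Mb : stab_form_bound S M) (D0 : 0 < D).
(* both equivalence constants between the energy norm and the H1-norm *)
Let C := (Num.sqrt `|M| + D) / Num.sqrt (beta S).

Lemma energy_estimate (g : nat -> R) : (forall j, 0 <= g j) ->
    (forall n, energy_norm (x n.+1) <= energy_norm (x n) + D * g n) ->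
  forall n, rnorm (x n) <= C * (rnorm (x 0%N) + \sum_(j < n) g j).
Proof.
move=> g0 step n; have b0 : 0 < Num.sqrt (beta S) by rewrite sqrtr_gt0 beta_gt0.
rewrite /C mulrAC ler_pdivlMr // mulrC.
apply: (le_trans (energy_norm_lb S_ell _)); apply: (le_trans (ler_telescope step n)).
rewrite -mulr_sumr; have := energy_norm_ub (x 0%N) Mb.
have s0 : 0 <= \sum_(j < n) g j by apply: sumr_ge0.
have := mulr_ge0 (ltW D0) (rnorm_ge0 (x 0%N)).
have := mulr_ge0 (sqrtr_ge0 `|M|) s0; lra.
Qed.

End EnergyEstimate.

Section RhsInf.
Variables (R : realType) (S : setting R) (m : nat) (k : R) (G : 'I_m -> H0 S).

Lemma rhs_inf_glb (a : R) : (forall W : 'I_m -> H1 S, in_Hh W ->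
    a <= pnorm W + (Num.sqrt k)^-1 * pnorm (fun i => G i - emb S (W i))) ->
  a <= rhs_inf k G.
Proof.
move=> le; apply: lb_le_inf.
  pose W0 (_ : 'I_m) : H1 S := 0.
  exists (pnorm W0 + (Num.sqrt k)^-1 * pnorm (fun i => G i - emb S (W0 i))).
  by exists W0 => // j; rewrite rpred0.
by move=> _ [W WH <-]; apply: le.
Qed.

Lemma rhs_inf_ge0 : 0 <= rhs_inf k G.
Proof.
apply: rhs_inf_glb => W _.
by rewrite addr_ge0 ?pnorm_ge0 // mulr_ge0 ?invr_ge0 ?sqrtr_ge0 ?pnorm_ge0.
Qed.

End RhsInf.

Unset Implicit Arguments.
Set Strict Implicit.

Theorem lemma3p4 (R : realType) (m : nat) (rk : rk_method R m)
    (rk_stable : A_stable rk) (rkA_inv : rkA rk \in unitmx) :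
  [/\ (exists2 C : R, 0 < C &
        forall (S : setting R) (k : R) (F : nat -> 'I_m -> H0 S)
          (x : nat -> H1 S) (X : nat -> 'I_m -> H1 S),
        0 < k -> rk_solution rk k F x X ->
        forall n : nat,
          rnorm (emb S (x n))
            <= rnorm (emb S (x 0%N)) + C * \sum_(j < n) pnorm (F j)),
      (forall b M K : R, 0 < b -> exists2 C : R, 0 < C &
        forall (S : setting R) (k : R) (F : nat -> 'I_m -> H0 S)
          (x : nat -> H1 S) (X : nat -> 'I_m -> H1 S),
        beta S = b -> elliptic S -> stab_form_bound S M ->
        0 < k -> k * alpha S <= K -> rk_solution rk k F x X ->
        forall n : nat,
          rnorm (x n)
            <= C * (rnorm (x 0%N) + \sum_(j < n) rhs_inf k (F j))),
      (forall b M : R, 0 < b -> exists2 C : R, 0 < C &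
        forall (S : setting R) (k : R) (F : nat -> 'I_m -> H1 S)
          (x : nat -> H1 S) (X : nat -> 'I_m -> H1 S),
        beta S = b -> elliptic S -> stab_form_bound S M ->
        0 < k -> (forall j, in_Hh (F j)) ->
        rk_solution rk k (fun j => pemb (F j)) x X ->
        forall n : nat,
          rnorm (x n) <= C * (rnorm (x 0%N) + \sum_(j < n) pnorm (F j)))
    & ((forall t : R, rnorm (stab_fun rk (t *i)) = 1) ->
        forall (S : setting R) (k : R)
          (x : nat -> H1 S) (X : nat -> 'I_m -> H1 S),
        0 < k -> rk_solution rk k (fun _ _ => 0) x X ->
          (forall n : nat, rnorm (emb S (x n)) = rnorm (emb S (x 0%N)))
          /\ (elliptic S -> forall n : nat,
                hform S (x n) (x n) = hform S (x 0%N) (x 0%N)))].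
Proof.
have [K K0 KP] := rk_response_bound rk_stable rkA_inv.
have K0' := ltW K0.
split.
- exists (m.+1%:R * K); first by rewrite mulr_gt0.
  move=> S k F x X k0 sol n; rewrite mulr_sumr.
  exact: (ler_telescope (fun i => H0_step rk_stable rkA_inv KP sol i K0')).
- move=> b M K2 b0.
  have K21 : 0 < 1 + `|K2| by rewrite ltr_pwDl.
  pose D := m.+1%:R * (K * (1 + Num.sqrt `|M| + Num.sqrt (1 + `|K2|))).
  have D0 : 0 < D by rewrite !mulr_gt0 // addr_gt0 ?sqrtr_gt0 // ltr_pwDl ?sqrtr_ge0.
  exists ((Num.sqrt `|M| + D) / Num.sqrt b).
    by rewrite divr_gt0 ?sqrtr_gt0 // ltr_wpDl ?sqrtr_ge0.
  move=> S k F x X Sb ell Mb k0 kK sol; rewrite -Sb.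
  apply: (energy_estimate ell Mb D0 (g := fun j => rhs_inf k (F j))) => [j|n].
    exact: rhs_inf_ge0.
  rewrite -lerBlDl mulrC -ler_pdivrMr //; apply: rhs_inf_glb => W WH.
  rewrite ler_pdivrMr // lerBlDl.
  (* the energy step holds for every W, so the increment is below the infimum *)
  have kK' := le_trans kK (ler_norm K2).
  apply: (le_trans (energy_step rk_stable rkA_inv KP k0 sol ell n K0' Mb kK' WH)).
  rewrite lerD2l [leRHS]mulrC /D -[leRHS]mulrA ler_wpM2l //.
  rewrite -[leRHS]mulrA -!(mulrA K) -(mulrDr K) ler_wpM2l //.
  set s := Num.sqrt k; set p := pnorm W; set q := s^-1 * pnorm _.
  have p0 : 0 <= p by exact: pnorm_ge0.
  have q0 : 0 <= q by rewrite mulr_ge0 ?invr_ge0 ?sqrtr_ge0 ?pnorm_ge0.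
  have := mulr_ge0 (sqrtr_ge0 `|M|) q0.
  have := mulr_ge0 (sqrtr_ge0 (1 + `|K2|)) p0.
  lra.
- move=> b M b0.
  (* take W = F n in the energy step: the remainder vanishes *)
  pose D := m.+1%:R * (K * (1 + Num.sqrt `|M|)).
  have D0 : 0 < D by rewrite !mulr_gt0 // ltr_pwDl ?sqrtr_ge0.
  exists ((Num.sqrt `|M| + D) / Num.sqrt b).
    by rewrite divr_gt0 ?sqrtr_gt0 // ltr_wpDl ?sqrtr_ge0.
  move=> S k F x X Sb ell Mb k0 FH sol; rewrite -Sb.
  apply: (energy_estimate ell Mb D0 (g := fun j => pnorm (F j))) => [j|n].
    exact: pnorm_ge0.
  apply: (le_trans (energy_step rk_stable rkA_inv KP k0 sol ell n K0' Mb (lexx _) (FH n))).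
  have -> : pnorm (fun j => pemb (F n) j - emb S (F n j)) = 0.
    rewrite /pnorm big1 ?sqrtr0 // => j _.
    by rewrite /pemb subrr rnorm0 expr0n.
  rewrite !mulr0 addr0 lerD2l /D -!mulrA ler_wpM2l // ler_wpM2l //.
  by rewrite mulrDl mul1r lerDr pnorm_ge0.
- move=> unimod S k x X k0 sol.
  have cons := conserved_step rk_stable rkA_inv unimod sol.
  by split=> [|_]; elim=> [//|n IH]; rewrite -IH; have [] := cons n.
Qed.
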